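(* Let $n\in\mathbb{N}$. The number $N_n$ of distinct $n\times n$ principal reversible squares is \[N_n=\sum_{j=1}^{\Omega(n)}c_j(n)\big(c_j(n)+c_{j+1}(n)\big)=\sum_{j=1}^{\Omega(n)}c_j^{(0)}(n)\,c_j^{(1)}(n).\]
   Context: For $j,n\in\mathbb{N}$, $c_j(n)$ is the number of ordered $j$-tuples of integers each $\ge 2$ with product $n$; $c_j^{(0)}=c_j$ and $c_j^{(1)}(n)=\sum_{m\mid n}c_j(m)$. If $n=p_1^{a_1}\cdots p_t^{a_t}$ is the prime factorisation, $\Omega(n)=a_1+\dots+a_t$. A reversible square matrix is a real matrix $M=(M_{i,j})$ with indices $i,j\in\mathbb{Z}_n=\mathbb{Z}/n\mathbb{Z}$ (the top-left entry having index $(1,1)$, with indices computed modulo $n$) such that (R) $M_{i,j}+M_{i,n+1-j}=M_{i,k}+M_{i,n+1-k}$ and $M_{i,j}+M_{n+1-i,j}=M_{k,j}+M_{n+1-k,j}$ for all $i,j,k\in\mathbb{Z}_n$, and (V) $M_{i,j}+M_{k,l}=M_{i,l}+M_{k,j}$ for all $i,j,k,l\in\mathbb{Z}_n$. An $n\times n$ principal reversible square is a reversible square matrix whose set of entries is exactly $\{1,2,\dots,n^2\}$, whose entries increase along each row (left to right) and each column (top to bottom), and which satisfies $M_{1,1}=1$, $M_{1,2}=2$. *)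

(* Defs.v *)
From mathcomp Require Import all_boot all_order all_algebra.
Set Implicit Arguments. Unset Strict Implicit. Unset Printing Implicit Defensive.

Definition bigOmega (n : nat) : nat := \sum_(p <- primes n) logn p n.

(* c j n = number of ordered j-tuples of integers >= 2 whose product is n.
   For n >= 1 every such entry divides n, hence lies in [2, n], so tuples
   with entries in 'I_n.+1 = {0,...,n} capture all of them. *)
Definition c (j n : nat) : nat :=
  #|[set t : j.-tuple 'I_n.+1 |
       all (fun x : 'I_n.+1 => 2 <= x) t && ((\prod_(x <- t) (x : nat)) == n)]|.

Definition c1 (j n : nat) : nat := \sum_(m <- divisors n) c j m.

(* Indices of Z_n = {1,...,n} are represented 0-based by 'I_n: the paper's
   index i corresponds to ordinal i-1; the paper's n+1-j corresponds to
   rev_ord (value n-1-(j-1)). *)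
Definition reversible (n : nat) (M : 'M[nat]_n) : Prop :=
  (forall i j k : 'I_n,
      M i j + M i (rev_ord j) = M i k + M i (rev_ord k)) /\
  (forall i j k : 'I_n,
      M i j + M (rev_ord i) j = M k j + M (rev_ord k) j) /\
  (forall i j k l : 'I_n, M i j + M k l = M i l + M k j).

Definition principal_reversible_square (n : nat) (M : 'M[nat]_n) : Prop :=
  reversible M /\
  (forall v : nat, (exists i j : 'I_n, M i j = v) <-> (1 <= v <= n ^ 2)) /\
  (forall i j k : 'I_n, (j < k)%N -> M i j < M i k) /\
  (forall i j k : 'I_n, (i < k)%N -> M i j < M k j) /\
  (forall i j : 'I_n, i = 0 :> nat -> j = 0 :> nat -> M i j = 1) /\
  (* M_{1,2} = 2, where the column index 2 is taken modulo n
     (0-based: 1 %% n) *)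
  (forall i j : 'I_n, i = 0 :> nat -> j = 1 %% n :> nat -> M i j = 2).

(* Main.v *)
Require Import Defs.
From mathcomp Require Import all_boot all_order all_algebra.
From mathcomp Require Import zify.

(** By (V), M_ij = 1 + r_i + s_j with r_0 = s_0 = 0, and a principal square
    amounts to two n-element sets A = {r_i}, B = {s_j} whose sums x + y hit every
    v < n^2 exactly once, with 1 in B.  De Bruijn's argument: if k is the least
    positive element of A, then A consists of multiples of k and B is a union of
    blocks [km, km + k), so dividing by k gives a tiling of [0, n^2/k) in which
    the roles of A and B are exchanged.  Iterating, the tiling is encoded by a
    list k_1, k_2, ... of integers >= 2 whose odd-indexed entries and
    even-indexed entries both have product n; conversely every such list gives
    a square, and (R) is then automatic because both sets are symmetric under
    reflection.  The two sublists have lengths (j, j) or (j + 1, j), which yields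
    the sum of c_j (c_j + c_{j+1}). *)

(** * Mixed-radix enumeration of the two sets *)

Fixpoint alternate (b : bool) (ks : seq nat) : seq nat :=
  if ks is k :: ks' then
    if b then k :: alternate false ks' else alternate true ks'
  else [::].

Definition alt_prod (b : bool) (ks : seq nat) : nat := \prod_(k <- alternate b ks) k.

(** [alt_enum true ks] enumerates B and [alt_enum false ks] enumerates A: in the
    mixed radix [ks], B (resp. A) is the set of numbers whose digits in even
    (resp. odd) 1-based position vanish.  Only arguments below [alt_prod b ks] matter;
    beyond them the enumeration just stays strictly increasing. *)
Fixpoint alt_enum (b : bool) (ks : seq nat) (x : nat) : nat :=
  if ks is k :: ks' then
    if b then x %% k + k * alt_enum false ks' (x %/ k) else k * alt_enum true ks' x
  else x.

Fixpoint alt_mem (b : bool) (ks : seq nat) (y : nat) : bool :=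
  if ks is k :: ks' then
    if b then alt_mem false ks' (y %/ k) else (k %| y) && alt_mem true ks' (y %/ k)
  else y == 0.

Lemma alt_prod_nil b : alt_prod b [::] = 1.
Proof. by case: b; rewrite /alt_prod big_nil. Qed.

Lemma alt_prod_cons b k ks :
  alt_prod b (k :: ks) = (if b then k else 1) * alt_prod (~~ b) ks.
Proof. by case: b; rewrite /alt_prod /= ?big_cons ?mul1n. Qed.

Lemma alt_prod_gt0 b ks : all (leq 2) ks -> 0 < alt_prod b ks.
Proof.
elim: ks b => [|k ks IH] b /=; first by case: b; rewrite /alt_prod big_nil.
case/andP=> k2 /IH h; rewrite alt_prod_cons muln_gt0 h andbT.
by case: b => //; apply: ltnW.
Qed.

Lemma divn_modn_uniq k q r : r < k -> (k * q + r) %/ k = q /\ (k * q + r) %% k = r.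
Proof.
move=> rk; rewrite mulnC divnMDl ?modnMDl; last exact: leq_ltn_trans rk.
by rewrite divn_small // modn_small // addn0.
Qed.

Lemma alt_enum0 b ks : alt_enum b ks 0 = 0.
Proof.
by elim: ks b => [|k ks IH] [] //=; rewrite ?div0n ?mod0n IH muln0.
Qed.

(** When the head [k] supplies a digit, equal quotients leave the order to the remainders; otherwise
    the recursive values differ by at least 1, and the factor [k] outweighs any remainder. *)
Lemma alt_enum_mono b ks :
  all (leq 2) ks -> {homo alt_enum b ks : x y / x < y}.
Proof.
elim: ks b => [|k ks IH] b /=; first by move=> _ x y.
case/andP=> k2 /IH h x y xy.
have k0 : 0 < k by apply: ltnW.
case: b; last by rewrite ltn_pmul2l ?h.
have mx := ltn_pmod x k0.
have [e|lt] : x %/ k = y %/ k \/ x %/ k < y %/ k.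
- by have := leq_div2r k (ltnW xy); rewrite leq_eqVlt => /orP[/eqP|]; [left|right].
- by rewrite e ltn_add2r; have := divn_eq x k; have := divn_eq y k; rewrite e; lia.
have lt' := h false _ _ lt.
have : k * (alt_enum false ks (x %/ k)).+1 <= k * alt_enum false ks (y %/ k).
  by rewrite leq_mul2l lt' orbT.
by rewrite mulnS; lia.
Qed.

Lemma alt_memP b ks y : all (leq 2) ks ->
  alt_mem b ks y <-> exists2 x, x < alt_prod b ks & alt_enum b ks x = y.
Proof.
elim: ks b y => [|k ks IH] b y /=.
  move=> _; split; first by move/eqP->; exists 0 => //; case: b; rewrite /alt_prod big_nil.
  by case: b => -[x]; rewrite /alt_prod big_nil ltnS leqn0 => /eqP-> <-.
case/andP=> k2 ks2; have k0 : 0 < k by apply: ltnW.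
rewrite alt_prod_cons; case: b => /=; split.
- case/IH=> // x xlt ex; exists (k * x + y %% k).
    rewrite -[X in _ < X]mulnC; have := ltn_pmod y k0.
    have : k * x.+1 <= k * alt_prod false ks by rewrite leq_mul2l xlt orbT.
    by rewrite mulnS mulnC; lia.
  have [-> ->] := divn_modn_uniq k x (y %% k) (ltn_pmod _ k0).
  by rewrite ex addnC mulnC -divn_eq.
- case=> x xlt <-; apply/IH => //; exists (x %/ k); first by rewrite ltn_divLR // mulnC.
  by rewrite addnC; case: (divn_modn_uniq k (alt_enum false ks (x %/ k)) (x %% k) (ltn_pmod _ k0)).
- case/andP=> /dvdnP[z ->]; rewrite mulnK // => /IH[] // x xlt <-.
  by exists x; rewrite ?mul1n // mulnC.
- case=> x; rewrite mul1n => xlt <-; rewrite dvdn_mulr //= mulKn //.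
  by apply/IH => //; exists x.
Qed.

(** Divide [v] by the head: the tail covers the quotient with the two sets exchanged, and the
    remainder becomes the lowest digit of the [true] summand. *)
Lemma alt_enum_cover ks v : all (leq 2) ks -> v < alt_prod true ks * alt_prod false ks ->
  exists x y, [/\ x < alt_prod true ks, y < alt_prod false ks
                & v = alt_enum true ks x + alt_enum false ks y].
Proof.
elim: ks v => [|k ks IH] v /=.
  by rewrite /alt_prod big_nil ltnS leqn0 => _ /eqP->; exists 0, 0.
case/andP=> k2 ks2; have k0 : 0 < k by apply: ltnW.
rewrite !alt_prod_cons /= mul1n => vlt.
have [|x [y [xlt ylt e]]] := IH (v %/ k) ks2.
  by rewrite ltn_divLR //; move: vlt; rewrite -mulnA mulnC [X in _ < X * _]mulnC.
exists (k * y + v %% k), x; split=> //.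
- have := ltn_pmod v k0.
  have : k * y.+1 <= k * alt_prod false ks by rewrite leq_mul2l ylt orbT.
  by rewrite mulnS; lia.
have [-> ->] := divn_modn_uniq k y (v %% k) (ltn_pmod _ k0).
by rewrite {1}(divn_eq v k) e; lia.
Qed.

(** Reflecting the argument complements each of its mixed-radix digits. This symmetry is what gives
    (R). *)
Lemma alt_enum_rev b ks x : all (leq 2) ks -> x < alt_prod b ks ->
  alt_enum b ks x + alt_enum b ks ((alt_prod b ks).-1 - x) = alt_enum b ks (alt_prod b ks).-1.
Proof.
elim: ks b x => [|k ks IH] b x /=.
  by case: b; rewrite /alt_prod big_nil /= => _; rewrite ltnS leqn0 => /eqP->.
case/andP=> k2 ks2; have k0 : 0 < k by apply: ltnW.
rewrite alt_prod_cons; case: b => /=; last first.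
  by rewrite mul1n => /IH h; rewrite -mulnDr h.
set P := alt_prod false ks => xlt.
have P0 : 0 < P by apply: alt_prod_gt0.
have qlt : x %/ k < P by rewrite ltn_divLR // mulnC.
have rlt := ltn_pmod x k0.
have hq : k * (x %/ k).+1 <= k * P by rewrite leq_mul2l qlt orbT.
have hP : k * P = k * P.-1 + k by rewrite -mulnSr prednK.
have e1 : (k * P).-1 = k * P.-1 + k.-1 by lia.
have e2 : (k * P).-1 - x = k * (P.-1 - x %/ k) + (k.-1 - x %% k).
  have ex := divn_eq x k; rewrite mulnC in ex.
  by move: hq ex rlt; rewrite mulnBr mulnS e1 hP; clear; lia.
rewrite e2 e1.
have [|-> ->] := divn_modn_uniq k (P.-1 - x %/ k) (k.-1 - x %% k); first by lia.
have [|-> ->] := divn_modn_uniq k P.-1 k.-1; first by lia.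
by rewrite -(IH false (x %/ k)) -/P // mulnDr; move: rlt; clear; lia.
Qed.

(** All digits are maximal here; this bounds the entries of a square from above. *)
Lemma alt_enum_top ks : all (leq 2) ks ->
  (alt_enum true ks (alt_prod true ks).-1 + alt_enum false ks (alt_prod false ks).-1).+1
    = alt_prod true ks * alt_prod false ks.
Proof.
elim: ks => [|k ks IH] /=; first by rewrite /alt_prod big_nil.
case/andP=> k2 ks2; have k0 : 0 < k by apply: ltnW.
rewrite !alt_prod_cons /= mul1n.
have P0 : 0 < alt_prod false ks by apply: alt_prod_gt0.
have -> : (k * alt_prod false ks).-1 = k * (alt_prod false ks).-1 + k.-1.
  by rewrite -{1}(prednK P0) mulnSr; lia.
have [|-> ->] := divn_modn_uniq k (alt_prod false ks).-1 k.-1; first by lia.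
by rewrite -mulnA [alt_prod false _ * _]mulnC -IH // mulnS mulnDr; lia.
Qed.

(** The sets and the total product determine the head; removing it exchanges the sets, which allows
    induction. *)
Lemma alt_mem_inj ks ks' : all (leq 2) ks -> all (leq 2) ks' ->
  alt_prod true ks * alt_prod false ks = alt_prod true ks' * alt_prod false ks' ->
  (forall b, alt_mem b ks =1 alt_mem b ks') -> ks = ks'.
Proof.
have pr1 k ls : all (leq 2) (k :: ls) ->
    k <= alt_prod true (k :: ls) * alt_prod false (k :: ls).
  case/andP=> _ h; rewrite !alt_prod_cons /= mul1n -mulnA leq_pmulr // muln_gt0.
  by rewrite !alt_prod_gt0.
have dig0 b ls : alt_mem b ls 0.
  by elim: ls b => [|k ls IH] [] //=; rewrite ?div0n ?IH ?dvdn0.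
(* If [ls] is not nil, k is the least positive element of
   [alt_mem false (k :: ls)], and k' divides all of its elements. *)
have key k ls k' ls' : all (leq 2) (k :: ls) -> all (leq 2) (k' :: ls') ->
    alt_prod true (k :: ls) * alt_prod false (k :: ls) =
      alt_prod true (k' :: ls') * alt_prod false (k' :: ls') ->
    (forall b, alt_mem b (k :: ls) =1 alt_mem b (k' :: ls')) -> k' <= k.
  move=> /= h h' e d; case: ls h e d => [|l ls] h e d.
    by move: (pr1 _ _ h'); rewrite -e !alt_prod_cons !alt_prod_nil ?muln1 ?mul1n.
  case/andP: h => k2 /= /andP[l2 _]; have := d false k.
  rewrite /= dvdnn divnn (ltnW k2) /= divn_small // dig0.
  by move/esym/andP=> [/dvdn_leq h _]; apply: h; apply: ltnW.
elim: ks ks' => [|k ks IH] [|k' ks'] //.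
- by move=> _ h e _; have /andP[/= k2 _] := h; have := pr1 _ _ h; rewrite -e !alt_prod_nil; lia.
- by move=> h _ e _; have /andP[/= k2 _] := h; have := pr1 _ _ h; rewrite e !alt_prod_nil; lia.
move=> h h' e d.
have ek : k = k'.
  by apply/eqP; rewrite eqn_leq (key _ _ _ _ h' h) ?(key _ _ _ _ h h') // => b x; rewrite d.
subst k'; case/andP: h => /= k2 h; case/andP: h' => /= _ h'.
have k0 : 0 < k by apply: ltnW.
congr (_ :: _); apply: IH => //.
- move: e; rewrite !alt_prod_cons /= !mul1n -!mulnA => /eqP.
  by rewrite eqn_pmul2l // => /eqP; rewrite mulnC => ->; rewrite mulnC.
case=> x.
- by have := d false (k * x); rewrite /= dvdn_mulr // mulKn.
- by have := d true (k * x); rewrite /= mulKn.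
Qed.

(** * Tilings of an initial segment *)

(** The interval [0, N) as a direct sum of [A] and [B]. *)
Definition tile (N : nat) (A B : pred nat) : Prop :=
  [/\ forall x y, A x -> B y -> x + y < N,
      forall v, v < N -> exists x y, [/\ A x, B y & v = x + y]
    & forall x y x' y', A x -> B y -> A x' -> B y' ->
        x + y = x' + y' -> x = x' /\ y = y'].

Lemma tile0 N A B : tile N A B -> 0 < N -> A 0 /\ B 0.
Proof. by case=> _ cov _ /cov[[|x] [[|y] []]]. Qed.

(** Induction over the blocks [km, km + k): once all earlier blocks are settled, the representation
    km = a + b decides the current one. *)
Lemma tile_blocks N A B k : tile N A B -> 0 < N -> 0 < k -> A k ->
  (forall x, A x -> 0 < x -> k <= x) ->
  forall x, (A x -> k %| x) /\ B x = B (k * (x %/ k)).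
Proof.
move=> t N0 k0 Ak Amin; have [A0 B0] := tile0 _ _ _ t N0.
case: t => bd cov inj.
suff block m r : r < k -> (A (k * m + r) -> r = 0) /\ B (k * m + r) = B (k * m).
  move=> x; have [hA hB] := block (x %/ k) (x %% k) (ltn_pmod _ k0).
  move: hA hB; rewrite mulnC -divn_eq => hA hB; split=> [/hA/eqP|] //.
elim/ltn_ind: m r => m IH r rk.
have IHB b : b < k * m -> k %| b -> B b -> forall s, s < k -> B (b + s).
  move=> bm /dvdnP[q eb] Bb s sk; rewrite eb mulnC.
  have [|_ ->] := IH q _ s sk; last by rewrite mulnC -eb.
  by rewrite -(ltn_pmul2l k0) mulnC -eb.
have IHA a : a < k * m -> A a -> k %| a.
  move=> am Aa; have q : a %/ k < m by rewrite ltn_divLR // mulnC.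
  by have [+ _] := IH _ q _ (ltn_pmod a k0); rewrite mulnC -divn_eq => /(_ Aa)/eqP.
have [Nkm|kmN] := leqP N (k * m).
  have nB x : k * m <= x -> B x = false.
    by move=> le; apply/negP=> /(bd _ _ A0); lia.
  by split=> [/bd/(_ B0)|]; [lia | rewrite !nB ?leq_addr].
have [a [b [Aa Bb e]]] := cov _ kmN.
(* If a > 0, both a and b are multiples of [k], and the block of [B] at b shifted by a already
   represents all of [km, km + k). By uniqueness [B] misses this block and [A] can contain only km
   from it. *)
have [a0|a0] := posnP a; last first.
  have ka : k %| a.
    have := leq_addr b a; rewrite -e leq_eqVlt => /orP[/eqP->|h].
      exact: dvdn_mulr.
    exact: IHA.
  have kb : k %| b by rewrite -(dvdn_addr _ ka) -e dvdn_mulr.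
  have Bbs s : s < k -> B (b + s) by apply: IHB => //; lia.
  have nB s : s < k -> B (k * m + s) = false.
    move=> sk; apply/negP => Bx.
    have [|] := inj _ _ _ _ A0 Bx Aa (Bbs s sk); first by lia.
    lia.
  split=> [Ax|]; last by rewrite -[in RHS](addn0 (k * m)) !nB.
  have [|] := inj _ _ _ _ Ax B0 Aa (Bbs r rk); first by lia.
  lia.
move: e; rewrite a0 add0n => e; rewrite -e in Bb.
(* Now km is in [B]. For m > 0, an s > 0 with km + s in [A] would give the two representations (km +
   s) + (k - s) = k + km. *)
have Ar s : s < k -> A (k * m + s) -> s = 0.
  move=> sk As; apply/eqP; rewrite -leqn0 leqNgt; apply/negP => s0.
  have [m0|m0] := posnP m.
    by have := Amin _ As; rewrite m0 muln0; lia.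
  have Bs : B (k - s).
    by rewrite -(add0n (k - s)); apply: IHB => //; [rewrite muln_gt0 k0 | lia].
  have [|] := inj _ _ _ _ As Bs Ak Bb; first by lia.
  by nia.
split; first exact: Ar.
(* Since k + km < N, the point km + r is covered by some a' + b'. A positive a' would yield a second
   representation of km. *)
rewrite Bb; have kmk := bd _ _ Ak Bb.
have [|a' [b' [Aa' Bb' e']]] := cov (k * m + r); first by lia.
have [a0'|a0'] := posnP a'; first by rewrite e' a0' add0n.
exfalso; have ka' := Amin _ Aa' a0'.
have [am|ma] := ltnP a' (k * m); last first.
  have ea : a' = k * m + (a' - k * m) by lia.
  have := Ar (a' - k * m); rewrite -ea => /(_ _ Aa') z.
  have ea' : a' = k * m by lia.
  by have [|] := inj _ _ _ _ Aa' B0 A0 Bb; lia.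
have /dvdnP[q ea] := IHA _ am Aa'.
(* The block of b' is an earlier one, so its left end is in [B]; replacing b' by that end lowers the
   sum from km + r to km. *)
have qlt : b' %/ k < m by rewrite ltn_divLR // mulnC; lia.
have rb := ltn_pmod b' k0.
have Bq : B (k * (b' %/ k)).
  by have [_ <-] := IH _ qlt _ rb; rewrite mulnC -divn_eq.
have eb := divn_eq b' k.
have e2 : a' + k * (b' %/ k) = k * m.
  have ea2 : a' + k * (b' %/ k) = k * (q + b' %/ k) by rewrite mulnDr ea mulnC.
  have eab : k * m + r = k * (q + b' %/ k) + b' %% k.
    by rewrite e' {1}eb -ea2 [b' %/ k * k]mulnC addnA.
  have := (divn_modn_uniq k m r rk).1.
  by rewrite eab (divn_modn_uniq k _ _ rb).1 ea2 => ->.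
by have [|] := inj _ _ _ _ Aa' Bq A0 Bb; lia.
Qed.


(** [A] and the block starts of [B] consist of multiples of [k]. After division the sets are listed
    in exchanged order, so that the second one contains 1 again. *)
Lemma tile_div N A B k : tile N A B -> 0 < N -> 0 < k -> A k ->
  (forall x, A x -> 0 < x -> k <= x) ->
  [/\ k %| N, tile (N %/ k) (fun x => B (k * x)) (fun x => A (k * x)),
      forall x, A x = (k %| x) && A (k * (x %/ k))
    & forall x, B x = B (k * (x %/ k))].
Proof.
move=> t N0 k0 Ak Amin; have blk := tile_blocks _ _ _ _ t N0 k0 Ak Amin.
case: t => bd cov inj.
have dA x : A x -> k %| x by case: (blk x).
have fB x s : k %| x -> B x -> s < k -> B (x + s).
  move=> /dvdnP[q ->] Bx sk; rewrite mulnC (blk _).2 (divn_modn_uniq k q s sk).1.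
  by rewrite mulnC.
have split v : k * v < N -> exists a b, [/\ A (k * a), B (k * b) & v = a + b].
  move=> /cov[x [y [Ax By e]]]; have kx := dA _ Ax.
  have ky : k %| y by rewrite -(dvdn_addr _ kx) -e dvdn_mulr.
  exists (x %/ k), (y %/ k); rewrite ![k * (_ %/ _)]mulnC !divnK //; split=> //.
  by apply/eqP; rewrite -(eqn_pmul2l k0) mulnDr ![k * (_ %/ _)]mulnC !divnK // e.
have kN : k %| N.
  have := divn_eq N k; have rk := ltn_pmod N k0.
  rewrite /dvdn; have [->//|r0] := posnP (N %% k) => eN.
  (* If N were not a multiple of [k], the last multiple below it would be ka + kb, and the full
     block of [B] at kb would push a sum to N or beyond. *)
  have [|a [b [Aa Bb e]]] := split (N %/ k); first by rewrite mulnC; lia.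
  have Bb' : B (k * b + k.-1) by apply: fB; rewrite ?dvdn_mulr //; lia.
  have := bd _ _ Aa Bb'; rewrite addnA -mulnDr -e mulnC; lia.
have eN : k * (N %/ k) = N by rewrite mulnC divnK.
split=> //; last by move=> x; have [] := blk x.
- split.
  + move=> x y Bx Ay; rewrite -(ltn_pmul2l k0) eN addnC mulnDr.
    exact: bd.
  + move=> v vN; have [|a [b [Aa Bb e]]] := split v.
      by rewrite -[X in _ < X]eN ltn_pmul2l.
    by exists b, a; rewrite addnC.
  + move=> x y x' y' Bx Ay Bx' Ay' e.
    have [|/eqP + /eqP] := inj _ _ _ _ Ay Bx Ay' Bx'.
      by rewrite -!mulnDr addnC e addnC.
    by rewrite !eqn_pmul2l // => /eqP-> /eqP->.
move=> x; apply/idP/andP => [Ax|[kx]]; last by rewrite mulnC divnK.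
by have kx := dA _ Ax; rewrite mulnC divnK.
Qed.

(** Strong induction on [N], one list entry per division. The last hypothesis fixes which set owns
    1, and it survives the exchange. *)
Lemma tile_alt_mem N A B : 0 < N -> tile N A B -> B 1 \/ N = 1 ->
  exists ks, [/\ all (leq 2) ks, alt_mem true ks =1 B, alt_mem false ks =1 A
                & N = alt_prod true ks * alt_prod false ks].
Proof.
elim/ltn_ind: N A B => N IH A B N0 t B1.
have [A0 B0] := tile0 _ _ _ t N0.
have [bd cov inj] := t.
have AN x : A x -> x < N by move=> /bd/(_ B0); rewrite addn0.
have BN x : B x -> x < N by move=> /(bd _ _ A0).
case: B1 => [B1|N1]; last first.
  exists [::]; rewrite !alt_prod_nil; split=> // x /=; apply/eqP/idP => [->//|].
    by move/BN; lia.
  by move/AN; lia.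
have N1 := BN _ B1.
(* If [A] has no positive element, [B] is the whole interval and the list is [[:: N]]. *)
have [/hasP[z zN Az]|/hasPn noA] := boolP (has A (iota 1 N)); last first.
  have Az x : A x = (x == 0).
    apply/idP/eqP => [Ax|->//]; apply/eqP; rewrite -leqn0 leqNgt; apply/negP => x0.
    by have := noA x; rewrite mem_iota Ax /= x0 => /(_ _)/negP; apply => //; have := AN _ Ax; lia.
  exists [:: N]; rewrite !alt_prod_cons !alt_prod_nil !muln1; split=> //=; first by rewrite N1.
    move=> y; rewrite -leqn0 leqNgt divn_gt0 // -ltnNge.
    apply/idP/idP => [/cov[a [b []]]|/BN //].
    by rewrite Az => /eqP-> Bb ->.
  move=> y; rewrite Az; have [->|y0] := posnP y; first by rewrite dvdn0 div0n.
  apply/negP=> /andP[/(dvdn_leq y0) Ny].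
  by rewrite -leqn0 leqNgt divn_gt0 // Ny.
have exA : exists x, (0 < x) && A x.
  by exists z; rewrite Az andbT; move: zN; rewrite mem_iota; lia.
have [k /andP[k0 Ak] kmin] := ex_minnP exA.
have Amin x : A x -> 0 < x -> k <= x by move=> Ax x0; apply: kmin; rewrite x0.
(* With k = 1, the number 1 would be in both sets and be represented as 1 + 0 and 0 + 1. *)
have k2 : 1 < k.
  rewrite ltn_neqAle k0 andbT; apply/eqP => k1; rewrite -k1 in Ak.
  by have [] := inj _ _ _ _ Ak B0 A0 B1 erefl.
have [kN t' eA eB] := tile_div _ _ _ _ t N0 k0 Ak Amin.
have [|||ks [h dB dA e]] := IH (N %/ k) _ _ _ _ t'.
- by rewrite ltn_Pdiv.
- by rewrite divn_gt0 // dvdn_leq.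
- by left; rewrite muln1.
exists (k :: ks); split=> /=.
- by rewrite k2.
- by move=> x; rewrite dA -eB.
- by move=> x; rewrite dB -eA.
by rewrite !alt_prod_cons /= mul1n -mulnA [alt_prod false _ * _]mulnC -e mulnC divnK.
Qed.

(** * Squares *)

(** Both value lists are strictly sorted with the same members, hence equal. Monotonicity of [f] is
    local because [f] will be read off a matrix through [inord]. *)
Lemma strict_enum_uniq n m (f g : nat -> nat) :
  {in gtn n &, {homo f : x y / x < y}} -> {homo g : x y / x < y} ->
  (forall v, (exists2 i, i < n & f i = v) <-> (exists2 i, i < m & g i = v)) ->
  n = m /\ forall i, i < n -> f i = g i.
Proof.
move=> fm gm fg.
have e : [seq f i | i <- iota 0 n] = [seq g i | i <- iota 0 m].
  apply: (irr_sorted_eq ltn_trans ltnn).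
  - apply: (homo_sorted_in (P := gtn n) fm) => //.
      by apply/allP=> x; rewrite mem_iota.
    exact: iota_ltn_sorted.
  - exact: (homo_sorted gm) (iota_ltn_sorted 0 m).
  move=> v; apply/mapP/mapP => -[i]; rewrite mem_iota /= => il ->.
    have /fg[j jl <-] : exists2 j, j < n & f j = f i by exists i.
    by exists j; rewrite ?mem_iota.
  have /fg[j jl <-] : exists2 j, j < m & g j = g i by exists i.
  by exists j; rewrite ?mem_iota.
have enm : n = m by have := congr1 size e; rewrite !size_map !size_iota.
split=> // i il; have := congr1 (fun s => nth 0 s i) e.
by rewrite -enm /= !(nth_map 0) ?size_iota // nth_iota.
Qed.

Definition admissible (n : nat) (ks : seq nat) : Prop :=
  [/\ all (leq 2) ks, alt_prod true ks = n & alt_prod false ks = n].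

(** Columns carry the [true] set, the one containing 1, because the entry next to the corner must be
    2. *)
Definition square (n : nat) (ks : seq nat) : 'M[nat]_n :=
  (\matrix_(i, j) (1 + alt_enum false ks i + alt_enum true ks j)%N)%R.

(** The first row and column give back both enumerations, hence both sets. *)
Lemma square_inj n ks ks' : 0 < n -> admissible n ks -> admissible n ks' ->
  square n ks = square n ks' -> ks = ks'.
Proof.
case: n => // n _ [h e0 e1] [h' e0' e1'] /matrixP e.
apply: alt_mem_inj => //; first by rewrite e0 e1 e0' e1'.
have prE b : alt_prod b ks = n.+1 /\ alt_prod b ks' = n.+1 by case: b.
suff E b x : x < n.+1 -> alt_enum b ks x = alt_enum b ks' x.
  move=> b y; have [p p'] := prE b.
  apply/idP/idP => /alt_memP[] // x xl <-; apply/alt_memP => //; exists x => //.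
  - by rewrite p' -p.
  - by rewrite -E // -p.
  - by rewrite p -p'.
  by rewrite E // -p'.
move=> xl; case: b.
- by have := e ord0 (Ordinal xl); rewrite !mxE /= !alt_enum0; lia.
- by have := e (Ordinal xl) ord0; rewrite !mxE /= !alt_enum0; lia.
Qed.

Lemma square_principal n ks : 1 < n -> admissible n ks ->
  principal_reversible_square (square n ks).
Proof.
move=> n1 [h e1 e0].
have m b := alt_enum_mono b ks h.
have rev b (j : 'I_n) : alt_enum b ks j + alt_enum b ks (rev_ord j) = alt_enum b ks n.-1.
  have prE : alt_prod b ks = n by case: b.
  have := alt_enum_rev b ks j h; rewrite prE => /(_ (ltn_ord j)) <- /=.
  by congr (_ + alt_enum b ks _); have := ltn_ord j; lia.
split; [split; [|split] | split; [|split; [|split; [|split]]]].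
- move=> i j k; rewrite !mxE; have := rev true j; have := rev true k; lia.
- move=> i j k; rewrite !mxE; have := rev false i; have := rev false k; lia.
- by move=> i j k l; rewrite !mxE; lia.
- move=> v; split.
    case=> i [j <-]; rewrite mxE; have := alt_enum_top ks h; rewrite e1 e0 mulnn.
    have := rev true j; have := rev false i; lia.
  case/andP=> v0 vn; have [|x [y []]] := alt_enum_cover ks v.-1 h.
    by rewrite e1 e0 mulnn; lia.
  rewrite e1 e0 => xl yl e; exists (Ordinal yl), (Ordinal xl).
  by rewrite mxE /=; lia.
- by move=> i j k jk; rewrite !mxE ltn_add2l m.
- by move=> i j k jk; rewrite !mxE ltn_add2r ltn_add2l m.
- by move=> i j i0 j0; rewrite !mxE i0 j0 !alt_enum0.
move=> i j i0; rewrite modn_small // => j1; rewrite mxE i0 j1 alt_enum0 addn0.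
(* As n > 1 the list has a head, which is at least 2, so 1 is a lowest digit and is enumerated as
   itself. *)
case: ks h e1 {m rev e0} => [|k ks] /=; first by rewrite alt_prod_nil; lia.
by case/andP=> k2 _ _; rewrite modn_small // divn_small // alt_enum0 muln0.
Qed.

Lemma principal_square n (M : 'M[nat]_n.+2) : principal_reversible_square M ->
  exists2 ks, admissible n.+2 ks & M = square n.+2 ks.
Proof.
case=> -[_ [_ V]] [val [row [col [M00 M01]]]].
have M1 i j : 0 < M i j by have /andP[] := (val (M i j)).1 (ex_intro _ i (ex_intro _ j erefl)).
have MN i j : M i j <= n.+2 ^ 2 by have /andP[] := (val (M i j)).1 (ex_intro _ i (ex_intro _ j erefl)).
have {}M00 : M ord0 ord0 = 1 by apply: M00.
have {}M01 : M ord0 (inord 1) = 2 by apply: M01; rewrite ?inordK.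
have ME i j : (M i j).-1 = (M i ord0).-1 + (M ord0 j).-1.
  have := V i j ord0 ord0; rewrite M00.
  by have := M1 i j; have := M1 i ord0; have := M1 ord0 j; lia.
pose A v := [exists i, (M i ord0).-1 == v].
pose B v := [exists j, (M ord0 j).-1 == v].
(* There are as many cells as values, so surjectivity forces injectivity; this yields uniqueness of
   sums in the tiling. *)
have injM : injective (fun p : 'I_n.+2 * 'I_n.+2 => M p.1 p.2).
  apply/injectiveP; apply: (@leq_size_uniq _ (iota 1 (n.+2 ^ 2))).
  - exact: iota_uniq.
  - move=> v; rewrite mem_iota => vb; have [|i [j <-]] := (val v).2; first by lia.
    by apply/codomP; exists (i, j).
  by rewrite size_codom card_prod card_ord size_iota mulnn.
have tAB : tile (n.+2 ^ 2) A B.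
  split.
  - move=> x y /existsP[i /eqP<-] /existsP[j /eqP<-]; rewrite -ME.
    by rewrite prednK.
  - move=> v vN; have [|i [j e]] := (val v.+1).2; first by lia.
    exists (M i ord0).-1, (M ord0 j).-1; rewrite -ME e; split=> //.
      by apply/existsP; exists i.
    by apply/existsP; exists j.
  move=> x y x' y' /existsP[i /eqP<-] /existsP[j /eqP<-] /existsP[i' /eqP<-] /existsP[j' /eqP<-].
  rewrite -!ME => e; have /injM[-> ->] // : M (i, j).1 (i, j).2 = M (i', j').1 (i', j').2.
  by move: e (M1 i j) (M1 i' j') => /=; lia.
have [||ks [h dB dA _]] := tile_alt_mem _ _ _ _ tAB.
- by rewrite expn_gt0.
- by left; apply/existsP; exists (inord 1); rewrite M01.
(* Equal increasing enumerations have equal lengths, which is where the product conditions of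
   [admissible] come from. *)
have enumE b (f : nat -> nat) : {in gtn n.+2 &, {homo f : x y / x < y}} ->
    (forall v, alt_mem b ks v <-> exists2 x, x < n.+2 & f x = v) ->
    alt_prod b ks = n.+2 /\ forall x, x < n.+2 -> f x = alt_enum b ks x.
  move=> fm fd; have [|<-] // := strict_enum_uniq n.+2 (alt_prod b ks) f _ fm (alt_enum_mono b ks h).
  by move=> v; have := alt_memP b ks v h; have := fd v; tauto.
have ltI x y : x \in gtn n.+2 -> y \in gtn n.+2 -> x < y -> (inord x : 'I_n.+2) < (inord y : 'I_n.+2).
  by rewrite !inE => xN yN; rewrite !inordK.
have [|v|e1 E1] := enumE true (fun x => (M ord0 (inord x)).-1).
- move=> x y xN yN /(ltI _ _ xN yN)/(row ord0); have := M1 ord0 (inord x); lia.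
- rewrite dB; split=> [/existsP[j /eqP<-]|[x xN <-]].
    by exists j => //; rewrite inord_val.
  by apply/existsP; exists (inord x).
have [|v|e0 E0] := enumE false (fun x => (M (inord x) ord0).-1).
- move=> x y xN yN /(ltI _ _ xN yN)/(col _ ord0); have := M1 (inord x) ord0; lia.
- rewrite dA; split=> [/existsP[i /eqP<-]|[x xN <-]].
    by exists i => //; rewrite inord_val.
  by apply/existsP; exists (inord x).
exists ks => //; apply/matrixP=> i j; rewrite mxE -E1 // -E0 // !inord_val.
by have := ME i j; have := M1 i j; lia.
Qed.

(** * Counting *)

Lemma size_alternate ks :
  size (alternate true ks) = uphalf (size ks) /\ size (alternate false ks) = half (size ks).
Proof.
elim: ks => [|k ks [IH1 IH0]] //=; by rewrite IH0 IH1.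
Qed.

Lemma all_alternate (a : pred nat) ks :
  all a ks = all a (alternate true ks) && all a (alternate false ks).
Proof. by elim: ks => [|k ks IH] //=; rewrite IH -andbA [all a (alternate false _) && _]andbC. Qed.

(** Inverse of the splitting by [alternate]. Under the length condition below, the default [p] has
    at most one entry and nothing of [q] is lost. *)
Fixpoint interleave (p q : seq nat) : seq nat :=
  match p, q with
  | k :: p', l :: q' => k :: l :: interleave p' q'
  | _, _ => p
  end.

Lemma alternate_interleave p q : size q <= size p <= (size q).+1 ->
  alternate true (interleave p q) = p /\ alternate false (interleave p q) = q.
Proof.
elim: p q => [|k p IH] [|l q] //=; first by case: p {IH}.
by rewrite !ltnS => /IH[-> ->].
Qed.

Lemma interleave_alternate ks : interleave (alternate true ks) (alternate false ks) = ks.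
Proof.
elim/ltn_ind: {ks}(size ks) {-2}ks (leqnn (size ks)) => m IH [|k [|l ks]] //= ksm.
by rewrite (IH (size ks)) //; lia.
Qed.

(** The tuples counted by [c] as plain sequences, so that different lengths share one type. *)
Definition factorizations (j n : nat) : seq (seq nat) :=
  [seq map val (val t) | t <- enum [set t : j.-tuple 'I_n.+1 |
     all (fun x : 'I_n.+1 => 2 <= x) t && ((\prod_(x <- t) (x : nat)) == n)]].

Lemma size_factorizations j n : size (factorizations j n) = c j n.
Proof. by rewrite size_map -cardE. Qed.

Lemma factorizations_uniq j n : uniq (factorizations j n).
Proof.
rewrite map_inj_uniq ?enum_uniq // => t u /(inj_map val_inj).
exact: val_inj.
Qed.

Lemma mem_factorizations j n s : 0 < n ->
  (s \in factorizations j n) = [&& size s == j, all (leq 2) s & \prod_(x <- s) x == n].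
Proof.
move=> n0; apply/mapP/and3P => [[t]|[/eqP sj s2 /eqP sn]].
  rewrite mem_enum inE => /andP[t2 tn] ->.
  by rewrite size_map size_tuple all_map big_map.
have le x : x \in s -> x < n.+1.
  move=> xs; rewrite ltnS dvdn_leq // -sn (big_rem x) //=.
  exact: dvdn_mulr.
have es : map val (map (fun x => inord x : 'I_n.+1) s) = s.
  by rewrite -map_comp -[RHS]map_id; apply/eq_in_map => x /le xn /=; rewrite inordK.
have szs : size (map (fun x => inord x : 'I_n.+1) s) == j by rewrite size_map sj.
exists (Tuple szs) => //=; rewrite mem_enum inE /=.
have -> : all (fun x : 'I_n.+1 => 2 <= x) (map (fun x => inord x) s) = all (leq 2) s.
  by rewrite -[in RHS]es [RHS]all_map.
by rewrite s2 -(big_map val xpredT id) es sn eqxx.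
Qed.

(** The divisor m = n contributes the first term; a proper divisor m contributes the (j + 1)-tuples
    whose first entry is n / m. *)
Lemma c1E j n : 0 < n -> c1 j n = c j n + c j.+1 n.
Proof.
move=> n0; rewrite /c1 (bigD1_seq n) ?divisors_uniq ?divisors_id //=; congr (_ + _).
rewrite -big_filter; set D := [seq _ <- _ | _].
have memD m : (m \in D) = (m != n) && (m %| n).
  by rewrite mem_filter dvdn_divisors.
have D0 m : m \in D -> [/\ 0 < m, 1 < n %/ m & m %| n].
  rewrite memD => /andP[mn mdn]; have m0 := dvdn_gt0 n0 mdn.
  have := dvdn_leq n0 mdn; rewrite leq_eqVlt (negPf mn) /= => mn'.
  by split; rewrite // ltn_divRL ?mul1n.
rewrite -size_factorizations.
have -> : size (factorizations j.+1 n) =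
    size [seq n %/ m :: s | m <- D, s <- factorizations j m].
  apply/perm_size/uniq_perm; first exact: factorizations_uniq.
    apply: allpairs_uniq_dep => //; first exact/filter_uniq/divisors_uniq.
      by move=> m _; apply: factorizations_uniq.
    move=> _ _ /allpairsPdep[m [s [mD sm ->]]] /allpairsPdep[m' [s' [mD' sm' ->]]] /= [_ e].
    have [m0 _ _] := D0 _ mD; have [m0' _ _] := D0 _ mD'.
    move: sm sm'; rewrite !mem_factorizations // e => /and3P[_ _ /eqP<-] /and3P[_ _ /eqP<-].
    by [].
  move=> s; rewrite mem_factorizations //; apply/and3P/allpairsPdep.
    case: s => [[]//|k s] [/= /eqP[sj]] /andP[k2 s2]; rewrite big_cons => /eqP sn.
    have k0 : 0 < k by apply: ltnW.
    set m := \prod_(x <- s) x in sn *.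
    have m0 : 0 < m by move: n0; rewrite -sn muln_gt0 => /andP[].
    exists m, s; rewrite memD mem_factorizations // sj s2 /= !eqxx -sn dvdn_mull // mulnK //.
    by rewrite andbT; split=> //; rewrite neq_ltn -{1}[m]mul1n ltn_pmul2r // k2.
  case=> m [t [/D0[m0 nm mn]]]; rewrite mem_factorizations // => /and3P[/eqP<- t2 /eqP tm] ->.
  by rewrite /= nm t2 big_cons tm divnK.
rewrite size_allpairs_dep sumnE big_map; apply: eq_bigr => m _.
by rewrite size_factorizations.
Qed.

(** * Number of prime factors as a bound on length *)

Lemma bigOmegaE N n : n < N -> bigOmega n = \sum_(p < N) logn p n.
Proof.
move=> nN; rewrite /bigOmega -(big_mkord xpredT (fun p => logn p n)).
rewrite [RHS](bigID (mem (primes n))) /= [X in _ + X]big1 ?addn0; last first.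
  by move=> p; rewrite -logn_gt0 lt0n negbK => /eqP.
rewrite -[RHS]big_filter; apply: perm_big; apply: uniq_perm.
- exact: primes_uniq.
- by rewrite filter_uniq ?iota_uniq.
move=> p; rewrite mem_filter mem_index_iota /=; case: (boolP (p \in primes n)) => //.
rewrite mem_primes => /and3P[_ n0 /(dvdn_leq n0) pn].
by symmetry; apply: leq_ltn_trans nN.
Qed.

Lemma bigOmegaM m n : 0 < m -> 0 < n -> bigOmega (m * n) = bigOmega m + bigOmega n.
Proof.
move=> m0 n0; rewrite !(bigOmegaE (m * n).+1) ?ltnS ?leq_pmulr ?leq_pmull //.
by rewrite -big_split; apply: eq_bigr => p _; rewrite lognM.
Qed.

Lemma bigOmega_gt0 n : 1 < n -> 0 < bigOmega n.
Proof.
move=> n1; have pn : pdiv n \in primes n by rewrite mem_primes pdiv_prime // pdiv_dvd ltnW.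
rewrite /bigOmega (big_rem (pdiv n)) //= addn_gt0.
by rewrite logn_gt0 pn.
Qed.

(** Each entry uses up at least one prime factor, so the sum up to [bigOmega n] misses no
    factorization. *)
Lemma size_le_bigOmega s : all (leq 2) s -> size s <= bigOmega (\prod_(x <- s) x).
Proof.
suff : all (leq 2) s -> 0 < \prod_(x <- s) x /\ size s <= bigOmega (\prod_(x <- s) x).
  by move=> h /h[].
elim: s => [|k s IH] /=; first by rewrite big_nil.
case/andP=> k2 /IH[s0 sz]; rewrite big_cons muln_gt0 s0 andbT bigOmegaM ?(ltnW k2) //.
split=> //.
by have := bigOmega_gt0 k k2; lia.
Qed.

(** * Admissible lists as pairs of factorizations *)

Definition factor_pairs (j n : nat) : seq (seq nat * seq nat) :=
  [seq (p, q) | p <- factorizations j n ++ factorizations j.+1 n,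
                q <- factorizations j n].

Lemma mem_factor_pairs j n p q : 0 < n ->
  (p, q) \in factor_pairs j n ->
  [/\ size q = j, size q <= size p <= (size q).+1,
      all (leq 2) p, all (leq 2) q & \prod_(x <- p) x = n /\ \prod_(x <- q) x = n].
Proof.
move=> n0 /allpairsP[[p' q'] /= [+ + [-> ->]]].
rewrite mem_cat !mem_factorizations // => hp /and3P[/eqP sq -> /eqP->]; move: hp.
by case/orP=> /and3P[/eqP sp -> /eqP->]; split; rewrite // sp sq ?leqnn ?leqnSn.
Qed.

Definition chains (n : nat) : seq (seq nat) :=
  [seq interleave pq.1 pq.2 | j <- index_iota 1 (bigOmega n).+1,
                              pq <- factor_pairs j n].

Lemma chains_uniq n : 0 < n -> uniq (chains n).
Proof.
move=> n0; apply: allpairs_uniq_dep; first exact: iota_uniq.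
  move=> j _; apply: allpairs_uniq; rewrite ?factorizations_uniq //.
    rewrite cat_uniq !factorizations_uniq andbT /=; apply/hasPn=> s.
    rewrite !mem_factorizations // => /and3P[/eqP sz _ _].
    by apply/negP=> /and3P[/eqP]; rewrite sz; lia.
  by case=> ? ? [? ?] _ _ [-> ->].
move=> _ _ /allpairsPdep[j [[p q] [_ pq ->]]] /allpairsPdep[j' [[p' q'] [_ pq' ->]]] /= e.
have [sq sz _ _ _] := mem_factor_pairs _ _ _ _ n0 pq.
have [sq' sz' _ _ _] := mem_factor_pairs _ _ _ _ n0 pq'.
have [ep eq] := alternate_interleave _ _ sz.
have [ep' eq'] := alternate_interleave _ _ sz'.
have epp : p = p' by rewrite -ep e.
have eqq : q = q' by rewrite -eq e.
by rewrite -sq -sq' epp eqq.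
Qed.

(** The number j of even-position entries is at most [bigOmega n], and j = 0 would leave their
    product equal to 1. *)
Lemma mem_chains n ks : 0 < n -> ks \in chains n <-> 1 < n /\ admissible n ks.
Proof.
move=> n0; split.
  case/allpairsPdep=> j [[p q] [+ pq ->]]; rewrite mem_index_iota => /andP[j1 _].
  have [sq sz p2 q2 [ep eq]] := mem_factor_pairs _ _ _ _ n0 pq.
  have [epi eqi] := alternate_interleave _ _ sz.
  split; last by split; rewrite /alt_prod ?epi ?eqi //= all_alternate epi eqi p2.
  have := size_le_bigOmega q q2; rewrite sq eq.
  case: n n0 {pq ep eq} => [|[|n]] //; rewrite /bigOmega big_nil; lia.
case=> n1 [ks2 e1 e0]; set p := alternate true ks; set q := alternate false ks.
have := ks2; rewrite all_alternate -/p -/q => /andP[p2 q2].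
have [sp sq] := size_alternate ks.
have szq : size q <= bigOmega n by rewrite -e0; apply: size_le_bigOmega.
have q0 : 0 < size q.
  by rewrite lt0n size_eq0; apply/eqP=> q0; move: e0 n1; rewrite /alt_prod -/q q0 big_nil; lia.
apply/allpairsPdep; exists (size q), (p, q); split=> /=.
- by rewrite mem_index_iota q0.
- apply/allpairsP; exists (p, q); split=> //=; rewrite ?mem_cat !mem_factorizations // ?p2 ?q2 /=.
    by rewrite -/(alt_prod true ks) e1 eqxx !andbT -/p sp sq uphalf_half; case: (odd _); rewrite ?eqxx ?orbT.
  by rewrite eqxx -/(alt_prod false ks) e0 eqxx.
by rewrite interleave_alternate.
Qed.

Lemma size_chains n :
  size (chains n) = \sum_(1 <= j < (bigOmega n).+1) c j n * (c j n + c j.+1 n).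
Proof.
rewrite size_allpairs_dep sumnE big_map; apply: eq_bigr => j _.
by rewrite size_allpairs size_cat !size_factorizations mulnC.
Qed.

Theorem theorem4 (n : nat) : 0 < n ->
  exists s : seq 'M[nat]_n,
    [/\ uniq s,
        (forall M : 'M[nat]_n, principal_reversible_square M <-> M \in s),
        size s = \sum_(1 <= j < (bigOmega n).+1) c j n * (c j n + c j.+1 n)
      & size s = \sum_(1 <= j < (bigOmega n).+1) c j n * c1 j n].
Proof.
move=> n0.
have sz : size (map (square n) (chains n)) =
    \sum_(1 <= j < (bigOmega n).+1) c j n * (c j n + c j.+1 n).
  by rewrite size_map size_chains.
exists (map (square n) (chains n)); split=> //.
- rewrite map_inj_in_uniq ?chains_uniq // => ks ks'.
  move=> /(mem_chains _ _ n0)[_ h] /(mem_chains _ _ n0)[_ h'].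
  exact: square_inj.
- move=> M; split=> [hM|/mapP[ks /(mem_chains _ _ n0)[n1 h] ->]]; last first.
    exact: square_principal.
  (* For n = 1 the column index 2 wraps around to 1, so the corner would be both 1 and 2 and no
     square exists. *)
  have n1 : 1 < n.
    rewrite ltn_neqAle n0 andbT; apply/eqP=> n1; subst n.
    case: hM => _ [_ [_ [_ [M1 M2]]]].
    by have := M1 ord0 ord0 erefl erefl; rewrite M2.
  case: n n0 n1 M hM {sz} => [|[|n]] // n0 n1 M hM.
  have [ks h ->] := principal_square _ _ hM.
  by apply: map_f; apply/mem_chains.
by rewrite sz; apply: eq_bigr => j _; rewrite c1E.
Qed.
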